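(* There exists $\kappa_0>0$ such that the following holds. Fix any $\kappa\in(0,\kappa_0)$ and any $\alpha\ge 4\kappa^2$. Then there exist $n_0\in\mathbb{N}$ and an absolute constant $c>0$ such that for every $n\ge n_0$ there is no $(e^{-cn},\alpha)$-online algorithm for the symmetric binary perceptron (in the sense defined in the context).
   Context: Let $\Sigma_n=\{-1,1\}^n$. Fix $\kappa>0$, $\alpha>0$ and set $M=\lfloor \alpha n\rfloor$. Let $\mathcal{M}\in\mathbb{R}^{M\times n}$ have i.i.d. standard normal entries, with columns $\mathcal{C}_1,\dots,\mathcal{C}_n\in\mathbb{R}^M$. For $p_s>0$, an algorithm $\mathcal{A}$ mapping $\mathcal{M}$ to $\boldsymbol{\sigma}_{\rm ALG}=\mathcal{A}(\mathcal{M})\in\Sigma_n$ is called $(p_s,\alpha)$-online for the symmetric binary perceptron (SBP) if: (Success) $\mathbb{P}\bigl[\|\mathcal{M}\boldsymbol{\sigma}_{\rm ALG}\|_\infty\le\kappa\sqrt{n}\bigr]\ge p_s$, where the probability is over $\mathcal{M}$; (Online) there exist deterministic functions $f_1,\dots,f_n$ such that for every $1\le t\le n$, $\boldsymbol{\sigma}_{\rm ALG}(t)=f_t(\mathcal{C}_1,\dots,\mathcal{C}_t)\in\{-1,1\}$. *)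

(* Defs.v *)
From HB Require Import structures.
From mathcomp Require Export all_boot all_order all_algebra.
From mathcomp Require Export all_classical all_reals all_analysis.
Export Order.TTheory GRing.Theory Num.Theory.

Set Implicit Arguments.
Unset Strict Implicit.
Unset Printing Implicit Defensive.

Local Open Scope classical_set_scope.
Local Open Scope ring_scope.

(* The cube {-1, 1}^n, as column vectors so that M *m s makes sense. *)
Definition sign_cube (R : realType) (n : nat) : set 'cV[R]_n :=
  [set s | forall i, s i ord0 = -1 \/ s i ord0 = 1].

(* The product sigma-algebra on m x n matrices, generated by the entries. *)
Definition matrix_measurable (R : realType) (m n : nat) : set (set 'M[R]_(m, n)) :=
  <<s [set B | exists i j (Y : set R),
         measurable Y /\ B = (fun M : 'M[R]_(m, n) => M i j) @^-1` Y] >>.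

Definition mutually_independent (R : realType) (d : measure_display)
    (T : measurableType d) (P : probability T R) (I : finType)
    (X : I -> {RV P >-> R}) : Prop :=
  forall (J : {set I}) (B : I -> set R),
    (forall k, k \in J -> measurable (B k)) ->
    P (\bigcap_(k in [set` J]) (X k @^-1` B k)) =
      (\prod_(k in J) P (X k @^-1` B k))%E.

Definition iid_std_normal (R : realType) (d : measure_display)
    (T : measurableType d) (P : probability T R) (m n : nat)
    (X : 'I_m -> 'I_n -> {RV P >-> R}) : Prop :=
  (forall i j (B : set R), measurable B ->
     distribution P (X i j) B = normal_prob 0 1 B) /\
  mutually_independent (fun k : 'I_m * 'I_n => X k.1 k.2).

Definition random_matrix (R : realType) (d : measure_display)
    (T : measurableType d) (P : probability T R) (m n : nat)
    (X : 'I_m -> 'I_n -> {RV P >-> R}) (w : T) : 'M[R]_(m, n) :=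
  \matrix_(i, j) X i j w.

(* The submatrix of the columns with (0-based) index at most t. *)
Definition columns_upto (R : realType) (m n : nat) (M : 'M[R]_(m, n))
    (t : 'I_n) : 'M[R]_(m, t.+1) :=
  colsub (widen_ord (ltn_ord t)) M.

(* `|_| is the entrywise maximum norm on matrices (mx_normrE). *)
Definition sbp_success (R : realType) (kappa : R) (m n : nat)
    (A : 'M[R]_(m, n) -> 'cV[R]_n) : set 'M[R]_(m, n) :=
  [set M | `|M *m A M| <= kappa * Num.sqrt n%:R].

(* For 0 <= alpha, truncn is the floor. *)
Definition sbp_rows (R : realType) (alpha : R) (n : nat) : nat :=
  Num.truncn (alpha * n%:R).

(* The (ps, alpha)-online property of A. The success set has to be measurable
   for its probability to be defined; this holds whenever A is measurable, and
   no other regularity is asked of A or of the functions f t. Measurability is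
   required in the space of matrices rather than in T, so that the sigma-algebra
   of T cannot turn a non-Borel set of matrices into an event. *)
Definition online_sbp (R : realType) (kappa ps alpha : R) (n : nat)
    (d : measure_display) (T : measurableType d) (P : probability T R)
    (X : 'I_(sbp_rows alpha n) -> 'I_n -> {RV P >-> R})
    (A : 'M[R]_(sbp_rows alpha n, n) -> 'cV[R]_n) : Prop :=
  [/\ forall M, A M \in @sign_cube R n,
      matrix_measurable (sbp_success kappa A),
      (ps%:E <= P (random_matrix X @^-1` sbp_success kappa A))%E
    & exists f : forall t : 'I_n, 'M[R]_(sbp_rows alpha n, t.+1) -> R,
        forall t M, A M t ord0 = f t (columns_upto M t)].

(* Main.v *)
(* Condition on the first [n - 3 K] columns, where [K] is the integer part of
   [kappa ^ 2 n]. They determine the first [n - 3 K] signs of an online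
   algorithm, so that only the last [3 K] signs remain free. For each of the
   [2 ^ (3 K)] choices of these, every entry of the product of the matrix with the
   sign vector is a constant plus a centred Gaussian of variance [3 K], which lies
   in an interval of length [2 kappa sqrt n] with probability at most
   [q = 2 kappa sqrt n / sqrt (6 pi K)]; the rows are independent. Since there are
   at least [4 K] rows and [q ^ 2] is at most about [1 / 3] (as [2 <= pi]), the
   union bound gives about [(8 / 9) ^ K], exponentially small in [n]. *)
From HB Require Import structures.
From mathcomp Require Import measurable_realfun ring lra zify.
Require Import Defs.

Set Implicit Arguments.
Unset Strict Implicit.
Unset Printing Implicit Defensive.

Local Open Scope classical_set_scope.
Local Open Scope ring_scope.

(** * Joint laws of independent random elements *)

Section joint_law.
Context d d1 d2 (T : measurableType d) (T1 : measurableType d1)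
  (T2 : measurableType d2) (R : realType) (P : probability T R).
Variables (f : T -> T1) (g : T -> T2).
Hypotheses (mf : measurable_fun setT f) (mg : measurable_fun setT g).
Hypothesis fg_indep : forall A B, measurable A -> measurable B ->
  P (f @^-1` A `&` g @^-1` B) = (P (f @^-1` A) * P (g @^-1` B))%E.

(** Independence makes the law of the pair the product of the two laws, so the measure of [C] is the
    average of the measures of its sections: [w] is frozen in the first argument, and [w'] acts as
    an independent copy. *)
Lemma decoupling (C : set (T1 * T2)) : measurable C ->
  P [set w | C (f w, g w)] = (\int[P]_w P [set w' | C (f w, g w')])%E.
Proof.
move=> mC.
pose f' : {mfun T >-> T1} := HB.pack f (isMeasurableFun.Build _ _ _ _ _ mf).
pose g' : {mfun T >-> T2} := HB.pack g (isMeasurableFun.Build _ _ _ _ _ mg).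
have mfg : measurable_fun setT (fun w => (f w, g w)).
  exact: measurable_fun_pair.
pose fg : {mfun T >-> (T1 * T2)%type} :=
  HB.pack (fun w => (f w, g w)) (isMeasurableFun.Build _ _ _ _ _ mfg).
rewrite -[LHS]/(distribution P fg C).
have fgE A B : measurable A -> measurable B -> distribution P fg (A `*` B) =
    (distribution P f' A * distribution P g' B)%E.
  by move=> mA mB; rewrite /distribution /pushforward/= -fg_indep.
rewrite -(product_measure_unique fgE)//.
rewrite /product_measure1 ge0_integral_distribution//.
- by apply: eq_integral => w _; rewrite /= /distribution /pushforward/= xsectionE.
- exact: measurable_fun_xsection.
Qed.

(** Turns a bound valid for every frozen value of [f] into a bound on the joint event. *)
Lemma decoupling_le (C : set (T1 * T2)) (b : R) : measurable C ->
  (forall w, (P [set w' | C (f w, g w')] <= b%:E)%E) ->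
  (P [set w | C (f w, g w)] <= b%:E)%E.
Proof.
move=> mC Cb; rewrite decoupling//.
pose g' : {mfun T >-> T2} := HB.pack g (isMeasurableFun.Build _ _ _ _ _ mg).
pose h w : \bar R := P [set w' | C (f w, g w')].
have mh : measurable_fun [set: T] h.
  have -> : h = (distribution P g' \o xsection C) \o f.
    by apply/funext => w /=; rewrite /distribution /pushforward/= xsectionE.
  by apply: measurableT_comp => //; exact: measurable_fun_xsection.
apply: (@le_trans _ _ (\int[P]_w b%:E)%E).
  by apply: ge0_le_integral => // *; exact: measure_ge0.
by rewrite integral_cst//= probability_setT mule1.
Qed.

End joint_law.

(** * Independence of generated sigma-algebras *)

Lemma setI_closed_indep d (T : measurableType d) (R : realType)
    (P : probability T R) (G : set (set T)) (F : set T) :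
  setI_closed G -> G `<=` measurable -> measurable F ->
  (forall E, G E -> P (E `&` F) = (P E * P F)%E) ->
  forall E, <<s G >> E -> P (E `&` F) = (P E * P F)%E.
Proof.
move=> GI Gm mF GF E sGE.
(* Dynkin's pi-lambda argument: these sets form a Dynkin system containing the pi-system [G], hence
   the sigma-algebra that [G] generates. *)
suff: [set E | measurable E /\ P (E `&` F) = (P E * P F)%E] E by case.
move: sGE; rewrite -setI_closed_g_dynkin_g_sigma_algebra//; apply.
split; last by move=> A GA; split; [exact: Gm|exact: GF].
split => /=.
- by rewrite setTI probability_setT mul1e.
- move=> A [mA PA]; split; first exact: measurableC.
  rewrite setIC -setDE measureD//; last first.
    by rewrite ltey_eq fin_num_measure.
  rewrite probability_setC// muleBl ?fin_num_measure//.
  by rewrite mul1e (setIC F A) /= PA.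
- move=> A tA mPA; split; first by apply: bigcup_measurable => k _; have [] := mPA k.
  rewrite setI_bigcupl measure_bigcup//=; last first.
  + exact: trivIset_setIr.
  + by move=> k _; apply: measurableI => //; have [] := mPA k.
  rewrite measure_bigcup//=; last by move=> k _; have [] := mPA k.
  have PF : P F = (fine (P F))%:E by rewrite fineK// fin_num_measure.
  rewrite /= muleC [in RHS]PF -nneseriesZl//=.
  by apply: eq_eseriesr => k _; rewrite -PF muleC; have [] := mPA k.
Qed.

Section cylinders.
Context d (T : measurableType d) (R : realType) (P : probability T R)
  (I : finType) (X : I -> {RV P >-> R}).
Implicit Types J K : {set I}.

(** Rectangles rather than single preimages, so that the family is closed under intersection. The
    sigma-algebra [events_of J] generated by it is that of the variables [X k] with [k] in [J]. *)
Definition cylinders J : set (set T) :=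
  [set E | exists B : I -> set R, (forall k, measurable (B k)) /\
    E = \bigcap_(k in [set` J]) (X k @^-1` B k)].

Definition events_of J : set (set T) := <<s cylinders J >>.

Lemma setI_closed_cylinders J : setI_closed (cylinders J).
Proof.
move=> _ _ [B [mB ->]] [C [mC ->]]; exists (fun k => B k `&` C k).
split; first by move=> k; exact: measurableI.
by rewrite -bigcapI; apply: eq_bigcapr => k _; rewrite preimage_setI.
Qed.

Lemma measurable_cylinders J : cylinders J `<=` measurable.
Proof.
move=> _ [B [mB ->]]; apply: fin_bigcap_measurable => // k _.
by rewrite -[X in measurable X]setTI; exact: measurable_funP.
Qed.

Lemma measurable_events_of J : events_of J `<=` measurable.
Proof.
apply: smallest_sub; [exact: sigma_algebra_measurable|exact: measurable_cylinders].
Qed.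

(** Two uses of [setI_closed_indep], one for each event, reduce the claim to a pair of cylinders,
    where it is mutual independence on the union of [J] and [K]. *)
Lemma indep_events_of J K (E F : set T) : mutually_independent X ->
  (forall k, k \in J -> k \notin K) -> events_of J E -> events_of K F ->
  P (E `&` F) = (P E * P F)%E.
Proof.
move=> indX JK sE sF.
apply: (setI_closed_indep (@setI_closed_cylinders J)) sE.
- exact: measurable_cylinders.
- exact: measurable_events_of sF.
move=> _ [B [mB ->]].
rewrite setIC [RHS]muleC.
apply: (setI_closed_indep (@setI_closed_cylinders K)) sF.
- exact: measurable_cylinders.
- by apply: (@measurable_cylinders J); exists B.
move=> _ [C [mC ->]].
(* As [J] and [K] are disjoint, the two families merge into one, and the intersection of the two
   cylinders is a cylinder over their union. *)
pose D k := if k \in J then B k else C k.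
have mD k : measurable (D k) by rewrite /D; case: ifP.
have DC k : k \in K -> D k = C k.
  by rewrite /D; case: ifP => // /JK/negbTE ->.
have -> : \bigcap_(k in [set` K]) (X k @^-1` C k) `&`
    \bigcap_(k in [set` J]) (X k @^-1` B k) =
    \bigcap_(k in [set` J :|: K]) (X k @^-1` D k).
  apply/seteqP; split => w /=.
    move=> [wK wJ] k /=; rewrite finset.in_setU => /orP[kJ|kK].
      by rewrite /D kJ; exact: wJ.
    by rewrite DC//; exact: wK.
  move=> wJK; split => k /= kJ.
    by rewrite -DC//; apply: wJK; rewrite /= finset.in_setU kJ orbT.
  by have := wJK k; rewrite /= finset.in_setU kJ /D kJ; exact.
have JK0 : fintype.disjoint (mem J) (mem K).
  by apply/pred0P => k /=; apply/negbTE/negP => /andP[/JK/negP].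
rewrite !indX// [RHS]muleC (eq_bigl (mem [predU J & K])); last first.
  by move=> k; rewrite finset.in_setU.
rewrite bigU//=; congr mule.
  by apply: eq_bigr => k kJ; rewrite /D kJ.
by apply: eq_bigr => k kK; rewrite DC.
Qed.

Lemma measurable_fun_events_of J k : k \in J ->
  measurable_fun [set: g_sigma_algebraType (cylinders J)] (X k).
Proof.
move=> kJ _ B mB; rewrite setTI; apply: sub_sigma_algebra.
exists (fun j => if j == k then B else setT); split; first by move=> j; case: ifP.
apply/seteqP; split => [w wB j /= _|w /(_ k)/=]; first by case: eqP => [->|].
by rewrite eqxx; exact.
Qed.

End cylinders.

(** * Normal laws: translation, reflection, convolution and small balls *)

Section normal_convolution.
Context {R : realType}.
Local Notation mu := (@lebesgue_measure R).
Implicit Types (m s v x z : R) (B : set R).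

(** Lebesgue measure is determined by its values on half-open intervals, whose length a translation
    preserves. *)
Lemma lebesgue_measure_addl x (A : set R) : measurable A ->
  pushforward mu (+%R x : _ -> measurableTypeR R) A = mu A.
Proof.
have mx : measurable_fun [set: measurableTypeR R]
    (+%R x : measurableTypeR R -> measurableTypeR R).
  exact: measurable_funD.
pose f : {mfun measurableTypeR R >-> measurableTypeR R} :=
  HB.pack (+%R x : measurableTypeR R -> measurableTypeR R)
    (isMeasurableFun.Build _ _ _ _ _ mx).
move=> mA; apply/esym/(@lebesgue_measure_unique _ (pushforward mu f)) => //=.
move=> _ [[a b]] _ <-; rewrite /pushforward /=.
have -> : +%R x @^-1` `]a, b] = `]a - x, b - x]%classic.
  by apply/seteqP; split => y /=; rewrite !in_itv/= ltrBlDl lerBrDl.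
rewrite !lebesgue_measure_itv/= !lte_fin ltrD2r.
by case: ifP => // _; rewrite -!EFinD; congr EFin; ring.
Qed.

Lemma normal_prob_addl x B : measurable B ->
  normal_prob 0 1 (+%R x @^-1` B) = normal_prob x 1 B.
Proof.
move=> mB; rewrite /normal_prob.
have mx : measurable_fun [set: measurableTypeR R]
    (+%R x : measurableTypeR R -> measurableTypeR R).
  exact: measurable_funD.
transitivity (\int[mu]_(y in +%R x @^-1` B) (normal_pdf x 1 (x + y))%:E)%E.
  apply: eq_integral => y _.
  by rewrite !normal_pdfE ?oner_neq0// /normal_fun subr0 [x + y]addrC addrK.
rewrite -(@ge0_integral_pushforward _ _ _ _ _ _ mx mu B
   (fun z => (normal_pdf x 1 z)%:E))//.
- by apply: eq_measure_integral => A mA AB; exact: lebesgue_measure_addl.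
- by apply/measurable_EFinP/measurable_funTS; exact: measurable_normal_pdf.
- by move=> z _; rewrite lee_fin normal_pdf_ge0.
Qed.

Lemma normal_prob_opp B : measurable B ->
  normal_prob 0 1 (-%R @^-1` B) = normal_prob 0 1 B.
Proof.
move=> mB; rewrite /normal_prob.
have mx : measurable_fun [set: measurableTypeR R]
    (-%R : measurableTypeR R -> measurableTypeR R).
  exact: measurable_funN.
transitivity (\int[mu]_(y in -%R @^-1` B) (normal_pdf 0 1 (- y))%:E)%E.
  apply: eq_integral => y _.
  by rewrite !normal_pdfE ?oner_neq0// /normal_fun !subr0 sqrrN.
rewrite -(@ge0_integral_pushforward _ _ _ _ _ _ mx mu B
   (fun z => (normal_pdf 0 1 z)%:E))//.
- by apply: eq_measure_integral => A mA AB; exact: lebesgue_measureN.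
- by apply/measurable_EFinP/measurable_funTS; exact: measurable_normal_pdf.
- by move=> z _; rewrite lee_fin normal_pdf_ge0.
Qed.

(** The Radon-Nikodym derivative of the normal law agrees almost everywhere with [normal_pdf], since
    both have the same integral over every measurable set. *)
Lemma integral_normal_prob m s (f : R -> \bar R) :
  (normal_prob m s).-integrable [set: R] f ->
  (\int[normal_prob m s]_x f x = \int[mu]_x (f x * (normal_pdf m s x)%:E))%E.
Proof.
move=> intf.
rewrite -(Radon_Nikodym_change_of_variables (@normal_prob_dominates _ m s))//=.
have mf := measurable_int _ intf.
apply: ae_eq_integral => //.
- apply: emeasurable_funM => //; apply: (measurable_int mu).
  by apply: Radon_Nikodym_integrable => /=; exact: normal_prob_dominates.
- apply: emeasurable_funM => //.
  by apply/measurable_EFinP; exact: measurable_normal_pdf.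
apply: ae_eqe_mul2l => /=.
rewrite Radon_NikodymE//=; first exact: normal_prob_dominates.
move=> dom; case: cid => /= h [h1 h2 h3].
apply: integral_ae_eq => //=.
- by apply/measurable_EFinP; exact: measurable_normal_pdf.
- by move=> E _ mE; rewrite -h3.
Qed.

(* Completing the square in [x]. *)
Lemma normal_pdf_conv v x z : 0 < v ->
  normal_pdf x 1 z * normal_pdf 0 (Num.sqrt v) x =
  normal_pdf 0 (Num.sqrt (v + 1)) z *
    normal_pdf (v / (v + 1) * z) (Num.sqrt (v / (v + 1))) x.
Proof.
move=> v0; have v10 : 0 < v + 1 by rewrite addr_gt0.
have q0 : 0 < v / (v + 1) by rewrite divr_gt0.
rewrite !normal_pdfE ?oner_neq0 ?gt_eqF ?sqrtr_gt0//.
rewrite /normal_fun /normal_peak !sqr_sqrtr ?ltW//.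
rewrite mulrACA -expRD [RHS]mulrACA -expRD; congr (_ * expR _).
  rewrite -!invfM -!sqrtrM ?mulrn_wge0 ?mulr_ge0 ?pi_ge0 ?ltW//.
  by congr (Num.sqrt _)^-1; field; rewrite gt_eqF.
by field; rewrite !gt_eqF.
Qed.

Lemma measurable_normal_pdf2 s : s != 0 ->
  measurable_fun [set: R * R] (fun p => normal_pdf p.1 s p.2).
Proof.
move=> s0.
rewrite (_ : (fun _ => _) = fun p : R * R => normal_peak s *
    expR (- (p.2 - p.1) ^+ 2 / (s ^+ 2 *+ 2))); last first.
  by apply/funext => p; rewrite normal_pdfE.
apply: measurable_funM => //; apply: measurableT_comp => //=.
apply: measurable_funM => //=; apply: measurableT_comp => //=.
by apply: measurable_funX => //=; exact: measurable_funB.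
Qed.

Lemma normal_prob_indic m s B : measurable B ->
  normal_prob m s B = (\int[mu]_z (normal_pdf m s z * \1_B z)%:E)%E.
Proof.
move=> mB; rewrite /normal_prob integral_mkcond; apply: eq_integral => z _.
by rewrite patchE indicE; case: (z \in B); rewrite ?mulr1 ?mulr0.
Qed.

Lemma measurable_normal_prob_mean B : measurable B ->
  measurable_fun [set: R] (fun x => normal_prob x 1 B).
Proof.
move=> mB.
pose g (p : R * R) := normal_pdf p.1 1 p.2 * \1_B p.2.
rewrite (_ : (fun _ => _) = fun x => (\int[mu]_z (g (x, z))%:E)%E); last first.
  by apply/funext => x; exact: normal_prob_indic.
apply: (@measurable_fun_fubini_tonelli_F _ _ _ _ _ mu (EFin \o g)).
  apply/measurable_EFinP/measurable_funM.
    exact: measurable_normal_pdf2 (oner_neq0 _).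
  by apply: measurableT_comp => //; exact: measurable_snd.
by move=> p; rewrite lee_fin mulr_ge0// ?normal_pdf_ge0.
Qed.

(** Tonelli swaps the integrals over the mean [x] and the point [z]; by [normal_pdf_conv] the inner
    integrand is then a factor in [z] times a normal density in [x], of total mass one. *)
Lemma normal_prob_conv v B : 0 < v -> measurable B ->
  (\int[normal_prob 0%R (Num.sqrt v)]_x normal_prob x 1 B =
   normal_prob 0 (Num.sqrt (v + 1)) B)%E.
Proof.
move=> v0 mB; have v10 : 0 < v + 1 by rewrite addr_gt0.
pose g (p : R * R) := normal_pdf p.1 1 p.2 * \1_B p.2.
have g0 p : 0 <= g p by rewrite mulr_ge0// ?normal_pdf_ge0.
have mg : measurable_fun [set: R * R] g.
  apply: measurable_funM; first exact: measurable_normal_pdf2 (oner_neq0 _).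
  by apply: measurableT_comp => //; exact: measurable_snd.
have nE x : normal_prob x 1 B = (\int[mu]_z (g (x, z))%:E)%E.
  exact: normal_prob_indic.
pose h x : \bar R := normal_prob x 1 B.
have mh : measurable_fun [set: R] h by exact: measurable_normal_prob_mean.
have h0 x : (0 <= h x)%E by exact: measure_ge0.
rewrite integral_normal_prob; last first.
  apply/integrableP; split => //.
  apply: (@le_lt_trans _ _ (\int[normal_prob 0%R (Num.sqrt v)]_x (cst 1 x))%E).
    apply: ge0_le_integral => //=; first exact: measurableT_comp.
    by move=> x _; rewrite gee0_abs//; exact: probability_le1.
  by rewrite integral_cst//= probability_setT mule1 ltry.
pose F (p : R * R) : \bar R := (g p * normal_pdf 0 (Num.sqrt v) p.1)%:E.
have F0 p : (0 <= F p)%E by rewrite lee_fin mulr_ge0 ?normal_pdf_ge0.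
have mF : measurable_fun setT F.
  apply/measurable_EFinP/measurable_funM => //.
  exact: measurableT_comp (measurable_normal_pdf _ _) measurable_fst.
transitivity (\int[mu]_x \int[mu]_z F (x, z))%E.
  apply: eq_integral => x _; rewrite nE -ge0_integralZr//.
  - by apply/measurable_EFinP; exact: measurableT_comp mg (measurable_pair1 x).
  - by move=> z _; rewrite lee_fin.
  - by rewrite lee_fin normal_pdf_ge0.
transitivity (\int[mu]_z \int[mu]_x F (x, z))%E.
  exact: (@fubini_tonelli _ _ _ _ _ mu mu F).
rewrite normal_prob_indic//.
apply: eq_integral => z _; rewrite /F /g /=.
under eq_integral do rewrite mulrAC normal_pdf_conv// mulrAC EFinM.
rewrite ge0_integralZl//.
- by rewrite integral_normal_pdf mule1.
- by apply/measurable_EFinP; exact: measurable_normal_pdf.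
- by move=> x _; rewrite lee_fin normal_pdf_ge0.
- by rewrite lee_fin mulr_ge0 ?normal_pdf_ge0.
Qed.

(** The density never exceeds [normal_peak s], and the interval has length [2 * r]. *)
Lemma normal_prob_itv_le (m s a r : R) : s != 0 -> 0 <= r ->
  (normal_prob m s [set y : R | (`|a + y| <= r)%R] <= (2 * r * normal_peak s)%:E)%E.
Proof.
move=> s0 r0.
pose D : set R := `[- r - a, r - a]%classic.
have -> : [set y : R | `|a + y| <= r] = D.
  apply/seteqP; split => y /=;
  by rewrite /D/= in_itv/= ler_norml lerBlDl lerBrDl.
have mD : measurable D by exact: measurable_itv.
rewrite /normal_prob.
apply: (@le_trans _ _ (\int[lebesgue_measure]_(x in D) (normal_peak s)%:E)%E).
  apply: ge0_le_integral => //.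
  - by move=> x _; rewrite lee_fin normal_pdf_ge0.
  - by apply/measurable_EFinP/measurable_funTS; exact: measurable_normal_pdf.
  - by move=> x _; rewrite lee_fin normal_pdf_ub.
rewrite integral_cst//= /D lebesgue_measure_itv/= lte_fin.
case: ifP => _; last by rewrite mule0 lee_fin !mulr_ge0 ?normal_peak_ge0.
by rewrite -EFinD -EFinM lee_fin mulrC ler_wpM2r ?normal_peak_ge0//; lra.
Qed.

End normal_convolution.

(** * Signed sums of independent standard normal variables *)

Section normal_laws.
Context d (T : measurableType d) (R : realType) (P : probability T R).

(** Freezing [U] makes the sum normal with mean [U w] and variance 1; decoupling averages this over
    the law of [U], and [normal_prob_conv] evaluates the average. *)
Lemma normal_law_add (U V : T -> R) (v : R) (B : set R) : 0 < v ->
  measurable_fun [set: T] U -> measurable_fun [set: T] V ->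
  (forall A, measurable A -> P (U @^-1` A) = normal_prob 0 (Num.sqrt v) A) ->
  (forall A, measurable A -> P (V @^-1` A) = normal_prob 0 1 A) ->
  (forall A A', measurable A -> measurable A' ->
    P (U @^-1` A `&` V @^-1` A') = (P (U @^-1` A) * P (V @^-1` A'))%E) ->
  measurable B ->
  P [set w | B (U w + V w)] = normal_prob 0 (Num.sqrt (v + 1)) B.
Proof.
move=> v0 mU mV lawU lawV UV mB.
pose C : set (R * R) := (fun p => p.1 + p.2) @^-1` B.
have mC : measurable C.
  rewrite -[C]setTI.
  have mD : measurable_fun [set: R * R] (fun p : R * R => p.1 + p.2).
    by apply: measurable_funD; [exact: measurable_fst|exact: measurable_snd].
  exact: mD.
rewrite (decoupling mU mV UV mC) -normal_prob_conv//.
transitivity (\int[P]_w normal_prob (U w) 1 B)%E.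
  apply: eq_integral => w _; rewrite -normal_prob_addl// -lawV//.
  have mx : measurable_fun [set: R] (+%R (U w)) by exact: measurable_funD.
  by rewrite -[X in measurable X]setTI; exact: mx.
(* [normal_prob] is a measure on [measurableTypeR R], whose display is not the
   one of the canonical measurable structure of [R]. *)
have mU' : measurable_fun [set: T] (U : T -> measurableTypeR R) by exact: mU.
pose U' : {mfun T >-> measurableTypeR R} :=
  HB.pack (U : T -> measurableTypeR R) (isMeasurableFun.Build _ _ _ _ _ mU').
have := @ge0_integral_distribution _ _ _ _ _ P U' (fun x => normal_prob x 1 B).
move=> /(_ (measurable_normal_prob_mean mB) (fun x => measure_ge0 _ _)) <-.
by apply: eq_measure_integral => A mA _; exact: lawU.
Qed.

Lemma normal_law_sign (V : T -> R) (t : R) (B : set R) : t = -1 \/ t = 1 ->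
  (forall A, measurable A -> P (V @^-1` A) = normal_prob 0 1 A) ->
  measurable B -> P [set w | B (t * V w)] = normal_prob 0 1 B.
Proof.
move=> t1 lawV mB.
have [->|->] := t1; last first.
  by under eq_set do rewrite mul1r; exact: lawV.
under eq_set do rewrite mulN1r.
rewrite -normal_prob_opp// -lawV//.
have mN : measurable_fun [set: R] (-%R : R -> R) by exact: measurable_funN.
by rewrite -[X in measurable X]setTI; exact: mN.
Qed.

End normal_laws.

Section signed_sums.
Context d (T : measurableType d) (R : realType) (P : probability T R)
  (I : finType) (X : I -> {RV P >-> R}).
Implicit Types (J : {set I}) (s : seq I) (t : I -> R).

Lemma measurable_sum_events_of J s t : {subset s <= J} ->
  measurable_fun [set: g_sigma_algebraType (cylinders X J)]
    (fun w => \sum_(k <- s) t k * X k w).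
Proof.
elim: s => [|k s IHs] sJ.
  by under eq_fun do rewrite big_nil; exact: measurable_cst.
under eq_fun do rewrite big_cons.
apply: measurable_funD; last by apply: IHs => j js; apply: sJ; rewrite inE js orbT.
apply: measurable_funM; first exact: measurable_cst.
by apply: measurable_fun_events_of; apply: sJ; rewrite inE eqxx.
Qed.

Lemma sum_events_of J s t (B : set R) : {subset s <= J} -> measurable B ->
  events_of X J ((fun w => \sum_(k <- s) t k * X k w) @^-1` B).
Proof.
by move=> sJ mB; have := measurable_sum_events_of t sJ measurableT mB; rewrite setTI.
Qed.

Lemma normal_law_sum s t (B : set R) : mutually_independent X ->
  (forall k A, measurable A -> distribution P (X k) A = normal_prob 0 1 A) ->
  (forall k, t k = -1 \/ t k = 1) -> uniq s -> (0 < size s)%N -> measurable B ->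
  P [set w | B (\sum_(k <- s) t k * X k w)] =
    normal_prob 0 (Num.sqrt (size s)%:R) B.
Proof.
move=> indX lawX t1; elim: s B => // k s IHs B /= /andP[ks us] _ mB.
have lawk A : measurable A ->
    P ((fun w => t k * X k w) @^-1` A) = normal_prob 0 1 A.
  by move=> mA; apply: normal_law_sign => //; exact: lawX.
(* The induction really starts at one term, because [normal_law_add] requires a positive
   variance. *)
have [/size0nil ->|s0] := posnP (size s).
  rewrite sqrtr1 -lawk//; congr (P _).
  by apply/seteqP; split => w /=; rewrite big_seq1.
under eq_set do rewrite big_cons addrC.
have sJ : {subset s <= [set j in s]%SET} by move=> j; rewrite finset.inE.
have kJ : {subset [:: k] <= [set k]%SET}.
  by move=> j; rewrite !finset.inE.
have kE : (fun w => t k * X k w) = fun w => \sum_(j <- [:: k]) t j * X j w.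
  by apply/funext => w; rewrite big_seq1.
rewrite -addn1 natrD; apply: normal_law_add => //.
- by rewrite ltr0n.
- move=> _ A mA; rewrite setTI.
  exact: measurable_events_of (sum_events_of t sJ mA).
- by apply: measurable_funM; [exact: measurable_cst|exact: measurable_funP].
- by move=> A mA; exact: IHs.
move=> A A' mA mA'.
apply: (@indep_events_of _ _ _ _ _ X [set j in s]%SET [set k]%SET) => //.
- by move=> j; rewrite !finset.inE => js; apply: contra ks => /eqP <-.
- exact: sum_events_of.
- by rewrite kE; exact: sum_events_of.
Qed.

End signed_sums.

(** * Union bound and auxiliary facts on matrices *)

Lemma probability_le_cover d (T : measurableType d) (R : realType)
    (P : probability T R) (I : eqType) (s : seq I) (E : I -> set T) (F : set T)
    (b : R) : measurable F ->
  (forall i, i \in s -> measurable (E i)) ->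
  (forall i, i \in s -> (P (E i) <= b%:E)%E) ->
  (forall w, F w -> exists2 i, i \in s & E i w) ->
  (P F <= (b *+ size s)%:E)%E.
Proof.
elim: s F => [|i s IHs] F mF mE Eb FE.
  rewrite (_ : F = set0) ?measure0//.
  by rewrite -subset0 => w /FE[].
have mEi : measurable (E i) by apply: mE; rewrite inE eqxx.
rewrite (measureDI _ mF mEi) mulrSr EFinD; apply: leeD.
  apply: IHs; first exact: measurableD.
  - by move=> j js; apply: mE; rewrite inE js orbT.
  - by move=> j js; apply: Eb; rewrite inE js orbT.
  - move=> w [/FE[j]]; rewrite inE => /orP[/eqP->//|js Ejw _].
    by exists j.
apply: le_trans (Eb i _); last by rewrite inE eqxx.
by apply: le_measure; rewrite ?inE//; exact: measurableI.
Qed.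

(** The sets with measurable preimage form a sigma-algebra, and it contains the generators because
    each entry of [F] is measurable. *)
Lemma matrix_measurable_preimage d (T : measurableType d) (R : realType) m n
    (F : T -> 'M[R]_(m, n)) (S : set 'M[R]_(m, n)) :
  (forall i j, measurable_fun [set: T] (fun w => F w i j)) ->
  matrix_measurable S -> measurable (F @^-1` S).
Proof.
move=> mF; suff : @matrix_measurable R m n `<=` [set S | measurable (F @^-1` S)].
  by apply.
apply: smallest_sub.
  split => [|A mA|A mA] /=.
  - by rewrite preimage_set0.
  - by rewrite setTD preimage_setC; apply: measurableC.
  - by rewrite preimage_bigcup; apply: bigcup_measurable => k _; exact: mA.
move=> _ [i [j [Y [mY ->]]]] /=.
by have := mF i j measurableT Y mY; rewrite setTI.
Qed.

Lemma mx_norm_le (R : realType) m n (N : 'M[R]_(m, n)) (r : R) :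
  `|N| <= r -> forall i j, `|N i j| <= r.
Proof.
move=> Nr i j; apply: le_trans Nr.
rewrite [`|N|]mx_normrE.
exact: (le_bigmax _ (fun ij => `|N ij.1 ij.2|) (i, j)).
Qed.

Lemma card_ord_geq n k : #|[set j : 'I_n | (k <= j)%N]%SET| = (n - k)%N.
Proof.
rewrite -sum1_card (eq_bigl (fun j : 'I_n => (k <= j)%N)); last first.
  by move=> j; rewrite finset.inE.
rewrite -(big_mkord (fun j => (k <= j)%N) (fun=> 1%N)).
by rewrite -(big_nat_widenl k 0 n xpredT)// sum_nat_const_nat muln1.
Qed.

(** * Gaussian matrices: row small balls, frozen columns and the success probability *)

Section gaussian_matrix.
Context d (T : measurableType d) (R : realType) (P : probability T R) (m n : nat)
  (X : 'I_m -> 'I_n -> {RV P >-> R}).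
Hypothesis iidX : iid_std_normal X.
Let entry (p : 'I_m * 'I_n) := X p.1 p.2.

Definition small_rows (cols : seq 'I_n) (t : 'I_n -> R) (a : 'I_m -> R) (r : R)
    (rows : seq 'I_m) : set T :=
  [set w | forall i, i \in rows ->
    `|a i + \sum_(j <- cols) t j * X i j w| <= r].

(** Each row contributes a factor [q] by [normal_prob_itv_le], and independence multiplies the
    factors. The induction also carries that the event depends only on entries in [rows], which
    makes it independent of the next row. *)
Lemma rows_small_ball (cols : seq 'I_n) (t : 'I_n -> R) (a : 'I_m -> R) (r : R)
    (rows : seq 'I_m) :
  uniq cols -> (0 < size cols)%N -> (forall j, t j = -1 \/ t j = 1) -> 0 <= r ->
  uniq rows ->
  (forall J : {set 'I_m * 'I_n}, (forall p, p.1 \in rows -> p \in J) ->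
    events_of entry J (small_rows cols t a r rows)) /\
  (P (small_rows cols t a r rows) <=
    ((2 * r * normal_peak (Num.sqrt (size cols)%:R)) ^+ size rows)%:E)%E.
Proof.
move=> ucols cols0 t1 r0; have [lawX indX] := iidX.
set q := 2 * r * _.
elim: rows => [_|i rows IHrows /= /andP[irows urows]].
  have -> : small_rows cols t a r [::] = setT by apply/seteqP; split.
  rewrite expr0 probability_setT; split => // J _.
  exact: (@measurableT _ (g_sigma_algebraType (cylinders entry J))).
have [mE0 PE0] := IHrows urows.
pose B := [set y : R | `|a i + y| <= r].
have mB : measurable B.
  rewrite (_ : B = `[- r - a i, r - a i]%classic); first exact: measurable_itv.
  by apply/seteqP; split => y /=; rewrite /B/= in_itv/= ler_norml lerBlDl lerBrDl.
pose s := [seq (i, j) | j <- cols].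
have sE (w : T) : \sum_(p <- s) t p.2 * entry p w = \sum_(j <- cols) t j * X i j w.
  by rewrite big_map.
pose Ei := (fun w => \sum_(p <- s) t p.2 * entry p w) @^-1` B.
have EE : small_rows cols t a r (i :: rows) =
    Ei `&` small_rows cols t a r rows.
  apply/seteqP; split => w.
    move=> Ew; split; first by rewrite /Ei/= sE /B/=; apply: Ew; rewrite inE eqxx.
    by move=> j js; apply: Ew; rewrite inE js orbT.
  move=> [Eiw E0w] j; rewrite inE => /orP[/eqP->|]; last exact: E0w.
  by move: Eiw; rewrite /Ei/= sE.
have PEi : (P Ei <= q%:E)%E.
  rewrite /Ei (normal_law_sum indX)//.
  - rewrite size_map; apply: normal_prob_itv_le => //.
    by rewrite gt_eqF// sqrtr_gt0 ltr0n.
  - by move=> p A mA; exact: lawX.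
  - by rewrite map_inj_uniq// => j j' [].
  - by rewrite size_map.
rewrite EE; split=> [J rowsJ|].
  apply: (@measurableI _ (g_sigma_algebraType (cylinders entry J))).
    apply: sum_events_of => // p /mapP[j _ ->].
    by apply: rowsJ; rewrite inE eqxx.
  by apply: mE0 => p prows; apply: rowsJ; rewrite inE prows orbT.
have J0 : forall p : 'I_m * 'I_n, p.1 \in rows -> p \in [set p | p.1 \in rows]%SET.
  by move=> p; rewrite finset.inE.
rewrite (indep_events_of indX _ _ (mE0 _ J0) (J := [set p | p.1 == i]%SET)).
- by rewrite exprS EFinM; apply: lee_pmul => //; exact: measure_ge0.
- by move=> p; rewrite !finset.inE => /eqP ->; exact: irows.
- by apply: sum_events_of => // p /mapP[j _ ->]; rewrite finset.inE.
Qed.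

(* The first [k] columns come from [w1] and the others from an independent copy
   [w2]; [mixed_matrix k w w] is [random_matrix X w]. *)
Definition mixed_matrix (k : nat) (w1 w2 : T) : 'M[R]_(m, n) :=
  \matrix_(i, j) if (j < k)%N then X i j w1 else X i j w2.

(** Sign [j] reads only columns of index at most [j < k], and these all come from [w1]. *)
Lemma online_mixed_sign k (A : 'M[R]_(m, n) -> 'cV[R]_n)
    (f : forall t : 'I_n, 'M[R]_(m, t.+1) -> R) w1 w2 w3 (j : 'I_n) :
  (forall t N, A N t ord0 = f t (columns_upto N t)) -> (j < k)%N ->
  A (mixed_matrix k w1 w2) j ord0 = A (mixed_matrix k w1 w3) j ord0.
Proof.
move=> Af jk; rewrite !Af; congr f; apply/matrixP => i j'.
have j'k : (widen_ord (ltn_ord j) j' < k)%N.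
  by rewrite (leq_ltn_trans _ jk)//= -ltnS ltn_ord.
by rewrite !mxE j'k.
Qed.

(** With [w1] frozen the early signs are constant, and a union bound over the patterns of the
    [n - k] late signs reduces success to [rows_small_ball]. *)
Lemma mixed_success_le k (A : 'M[R]_(m, n) -> 'cV[R]_n) (r : R)
    (f : forall t : 'I_n, 'M[R]_(m, t.+1) -> R) (S : set 'M[R]_(m, n)) w1 :
  (forall t N, A N t ord0 = f t (columns_upto N t)) ->
  (forall N, A N \in @sign_cube R n) ->
  matrix_measurable S -> (forall N, S N -> `|N *m A N| <= r) ->
  (k < n)%N -> 0 <= r ->
  (P [set w2 | S (mixed_matrix k w1 w2)] <=
   ((2 * r * normal_peak (Num.sqrt (n - k)%:R)) ^+ m *+ 2 ^ (n - k))%:E)%E.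
Proof.
move=> Af Asign mS Sr kn r0.
pose late := [set j : 'I_n | (k <= j)%N]%SET.
have late_size : size (enum late) = (n - k)%N by rewrite -cardE card_ord_geq.
(* The second argument [w1] is arbitrary: by [online_mixed_sign] the early signs do not depend on
   it. *)
pose a i := \sum_(j < n | (j < k)%N)
  X i j w1 * A (mixed_matrix k w1 w1) j ord0.
(* A pattern of late signs is encoded by the set [B] of columns with sign 1. *)
pose t (B : {set 'I_n}) j : R := if j \in B then 1 else -1.
have -> : (2 ^ (n - k))%N = size (enum (powerset late)).
  by rewrite -cardE card_powerset card_ord_geq.
pose E B := small_rows (enum late) (t B) a r (enum 'I_m).
have EP B : (forall J : {set 'I_m * 'I_n}, (forall p, p.1 \in enum 'I_m -> p \in J) ->
    events_of entry J (E B)) /\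
  (P (E B) <= ((2 * r * normal_peak (Num.sqrt (n - k)%:R)) ^+ m)%:E)%E.
  rewrite -late_size -[in X in (_ <= X)%E](size_enum_ord m).
  apply: rows_small_ball => //; try exact: enum_uniq.
  - by rewrite late_size subn_gt0.
  - by move=> j; rewrite /t; case: ifP; [right|left].
apply: (@probability_le_cover _ _ _ _ _ _ E).
- apply: (matrix_measurable_preimage _ mS) => i j.
  under eq_fun do rewrite mxE.
  by case: ltnP => _; [exact: measurable_cst|exact: measurable_funP].
- move=> B _; have [mE _] := EP B.
  by apply: measurable_events_of (mE [set: _]%SET _) => p _; rewrite finset.inE.
- by move=> B _; have [] := EP B.
move=> w2 SN; set N := mixed_matrix k w1 w2 in SN *.
have /set_mem/= signN := Asign N.
(* The pattern that [A] actually chooses on this matrix. *)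
exists [set j in late | A N j ord0 == 1]%SET.
  rewrite mem_enum powersetE; apply/fintype.subsetP => j.
  by rewrite finset.inE => /andP[].
move=> i _; have := mx_norm_le (Sr N SN) i ord0.
rewrite mxE (bigID (fun j : 'I_n => (j < k)%N))/=.
congr (`| _ + _ | <= _).
  apply: eq_bigr => j jk; rewrite mxE jk; congr (_ * _).
  exact: online_mixed_sign.
rewrite big_enum/=; apply: eq_big => [j|j]; first by rewrite finset.inE -leqNgt.
move=> jk; rewrite mxE (negbTE jk) mulrC; congr (_ * _).
rewrite /t !finset.inE [(k <= j)%N]leqNgt jk/=.
have [->|->] := signN j; last by rewrite eqxx.
by case: eqP => // /eqP; rewrite eqNr oner_eq0.
Qed.

(** The bound of [mixed_success_le] is uniform in [w1], and early and late columns are independent,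
    so [decoupling_le] applies. *)
Lemma online_success_le k (A : 'M[R]_(m, n) -> 'cV[R]_n) (r : R)
    (f : forall t : 'I_n, 'M[R]_(m, t.+1) -> R) (S : set 'M[R]_(m, n)) :
  (forall t N, A N t ord0 = f t (columns_upto N t)) ->
  (forall N, A N \in @sign_cube R n) ->
  matrix_measurable S -> (forall N, S N -> `|N *m A N| <= r) ->
  (k < n)%N -> 0 <= r ->
  (P (random_matrix X @^-1` S) <=
   ((2 * r * normal_peak (Num.sqrt (n - k)%:R)) ^+ m *+ 2 ^ (n - k))%:E)%E.
Proof.
move=> Af Asign mS Sr kn r0.
pose J := [set p : 'I_m * 'I_n | (p.2 < k)%N]%SET.
pose K := [set p : 'I_m * 'I_n | (k <= p.2)%N]%SET.
pose TJ := g_sigma_algebraType (cylinders entry J).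
pose TK := g_sigma_algebraType (cylinders entry K).
(* [TJ] and [TK] are [T] with two independent sub-sigma-algebras, and the
   decoupling is applied to the identity maps into them. *)
have mJ : measurable_fun [set: T] (id : T -> TJ).
  by move=> _ B mB; rewrite setTI; exact: measurable_events_of mB.
have mK : measurable_fun [set: T] (id : T -> TK).
  by move=> _ B mB; rewrite setTI; exact: measurable_events_of mB.
pose C : set (TJ * TK) := (fun w => mixed_matrix k w.1 w.2) @^-1` S.
have mC : measurable C.
  apply: (matrix_measurable_preimage _ mS) => i j.
  under eq_fun do rewrite mxE.
  have [jk|kj] := ltnP j k.
    have mX : measurable_fun [set: TJ] (X i j).
      by apply: (@measurable_fun_events_of _ _ _ _ _ entry J (i, j)); rewrite finset.inE.
    exact: (measurableT_comp mX measurable_fst).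
  have mX : measurable_fun [set: TK] (X i j).
    by apply: (@measurable_fun_events_of _ _ _ _ _ entry K (i, j)); rewrite finset.inE.
  exact: (measurableT_comp mX measurable_snd).
have -> : random_matrix X @^-1` S = [set w | C (w, w)].
  apply/seteqP; split => w; rewrite /C/=;
  by congr S; apply/matrixP => i j; rewrite !mxE; case: ifP.
apply: (decoupling_le mJ mK _ mC); last by move=> w; exact: mixed_success_le.
move=> B1 B2 mB1 mB2; apply: (@indep_events_of _ _ _ _ _ entry J K) => //.
- exact: iidX.2.
- by move=> p; rewrite !finset.inE -ltnNge.
Qed.

End gaussian_matrix.

(** * Numerical estimates and conclusion *)

Lemma normal_peak_sqr_le (R : realType) (v : R) : 0 < v ->
  normal_peak (Num.sqrt v) ^+ 2 <= (4 * v)^-1.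
Proof.
move=> v0; have pi0 := @pi_ge0 R; have pi2 := @pi_ge2 R.
(* The squared peak is [1 / (2 pi v)], so [2 <= pi] suffices. *)
have vpi : v * 2 <= v * pi by rewrite ler_pM2l.
rewrite /normal_peak (sqr_sqrtr (ltW v0)) exprVn -mulr_natr sqr_sqrtr; last lra.
by rewrite lef_pV2 ?posrE; lra.
Qed.

Lemma perceptron_union_bound (R : realType) (kappa : R) (n m K : nat) :
  0 < kappa -> (40 <= K)%N -> (4 * K <= m)%N -> kappa ^+ 2 * n%:R <= K.+1%:R ->
  (2 * (kappa * Num.sqrt n%:R) * normal_peak (Num.sqrt (3 * K)%:R)) ^+ m
    *+ 2 ^ (3 * K) <= (19 / 20 : R) ^+ K.
Proof.
move=> kappa0 K40 Km xK; set q := 2 * _ * _.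
have K0 : 40 <= K%:R :> R by rewrite (ler_nat R 40).
have q0 : 0 <= q.
  by rewrite !mulr_ge0 ?normal_peak_ge0 ?sqrtr_ge0 ?ltW.
(* The bound obtained is [(K + 1) / (3 K)], which decreases in [K] and equals [41 / 120] at
   [K = 40]. *)
have q2 : q ^+ 2 <= 41 / 120.
  have p2 : normal_peak (Num.sqrt (3 * K)%:R) ^+ 2 <= (12 * K%:R : R)^-1.
    apply: le_trans (normal_peak_sqr_le _) _; first by rewrite natrM; lra.
    by rewrite natrM mulrA (_ : 4 * 3%:R = 12 :> R) ?lexx//; ring.
  rewrite /q !exprMn sqr_sqrtr//.
  apply: (@le_trans _ _ (2 ^+ 2 * K.+1%:R * (12 * K%:R)^-1)).
    have x0 : 0 <= kappa ^+ 2 * n%:R by rewrite mulr_ge0 ?sqr_ge0.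
    by apply: ler_pM => //; [rewrite mulr_ge0|exact: sqr_ge0|rewrite ler_wpM2l].
  rewrite ler_pdivrMr; last lra.
  by rewrite -natr1; lra.
have q1 : q <= 1.
  by rewrite -(@ler_pXn2r _ 2)// ?nnegrE// expr1n; apply: le_trans q2 _; lra.
clearbody q; rewrite -mulr_natr natrX.
(* Since [q <= 1], rows beyond the first [4 K] may be dropped. *)
apply: (@le_trans _ _ (q ^+ (4 * K) * 2 ^+ (3 * K))).
  by rewrite ler_wpM2r// ler_wiXn2l.
rewrite (exprM q) (exprM 2) -exprMn.
apply: lerXn2r; rewrite ?nnegrE ?mulr_ge0 ?exprn_ge0//.
have -> : q ^+ 4 = (q ^+ 2) ^+ 2 by rewrite -exprM.
have q20 : 0 <= q ^+ 2 by exact: sqr_ge0.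
(* Numerically, [8 * (41 / 120) ^ 2] is about 0.934, below [19 / 20]. *)
nra.
Qed.

Theorem theorem2p3 (R : realType) :
  exists kappa0 : R, 0 < kappa0 /\
  forall kappa alpha : R, 0 < kappa -> kappa < kappa0 ->
    4 * kappa ^+ 2 <= alpha ->
  exists (n0 : nat) (c : R), 0 < c /\
  forall n : nat, (n0 <= n)%N ->
  forall (d : measure_display) (T : measurableType d) (P : probability T R)
    (X : 'I_(sbp_rows alpha n) -> 'I_n -> {RV P >-> R}),
    iid_std_normal X ->
    ~ exists A : 'M[R]_(sbp_rows alpha n, n) -> 'cV[R]_n,
        online_sbp kappa (expR (- c * n%:R)) X A.
Proof.
(* With [kappa < 1 / 2] one has [3 kappa ^ 2 < 1], so that [3 K] columns are available. *)
exists (1 / 2); split; first by lra.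
move=> kappa alpha kappa0 kappa_lt alpha_ge.
have kappa2 : 0 < kappa ^+ 2 by rewrite exprn_gt0.
(* The threshold forces [kappa ^ 2 n > 41], hence [K >= 40]. The rate is half of [kappa ^ 2 / 20],
   which absorbs the rounding of [kappa ^ 2 n] to [K]. *)
exists (Num.truncn (41 / kappa ^+ 2)).+1, (kappa ^+ 2 / 40).
split; first by rewrite divr_gt0.
move=> n n_ge d T P X iidX [A [Asign mS Psucc [f Af]]].
pose x := kappa ^+ 2 * n%:R; pose K := Num.truncn x.
have x41 : 41 < x.
  rewrite /x mulrC -ltr_pdivrMr//; apply: lt_le_trans (truncnS_gt _) _.
  by rewrite ler_nat.
have Kx : K%:R <= x by rewrite truncn_le; lra.
have xK : x < K.+1%:R by exact: truncnS_gt.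
have K40 : (40 <= K)%N by rewrite truncn_ge_nat; lra.
(* This is where [4 kappa ^ 2 <= alpha] enters. *)
have Km : (4 * K <= sbp_rows alpha n)%N.
  rewrite /sbp_rows truncn_ge_nat; last by rewrite mulr_ge0//; lra.
  rewrite natrM; apply: (@le_trans _ _ (4 * x)); first by rewrite ler_wpM2l.
  by rewrite /x mulrA ler_wpM2r.
have Kn : (3 * K <= n)%N.
  rewrite -(ler_nat R) natrM; apply: (@le_trans _ _ (3 * x)); first by rewrite ler_wpM2l.
  by rewrite /x mulrA ler_piMl//; nra.
have := online_success_le iidX Af Asign mS (fun N SN => SN)
  (k := n - 3 * K) _ _.
rewrite subKn// => /(_ _ _)/(le_trans Psucc).
rewrite lee_fin => H.
have : expR (- (kappa ^+ 2 / 40) * n%:R) <= (19 / 20) ^+ K.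
  apply: le_trans (H _ _) _; last exact: (perceptron_union_bound _ _ _ (ltW xK)).
    by rewrite ltn_subrL; lia.
  by rewrite mulr_ge0 ?sqrtr_ge0// ltW.
apply/negP; rewrite -ltNge.
(* From [1 + y <= expR y] at [y = - 1 / 20]; what remains is [x / 40 < K / 20], true because
   [K > x - 1] and [x > 41]. *)
apply: (@le_lt_trans _ _ (expR (- (1 / 20)) ^+ K)).
  by apply: lerXn2r; rewrite ?nnegrE ?expR_ge0//; apply: le_trans (expR_ge1Dx _); lra.
rewrite -expRM_natl ltr_expR mulNr mulrAC -/x.
by move: xK; rewrite -natr1 => ?; lra.
Qed.
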